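(* Let $\ell,b\in\mathbb R^n$ with $\ell_i<b_i$ for all $i$, let $[\ell,b]=\{x\in\mathbb R^n:\ell\le x\le b\}$, and let $\Phi$ be a real-valued continuously differentiable function with locally Lipschitz gradient on an open neighborhood of $[\ell,b]$. Let $g:\mathbb R^n\to\mathbb R^n$ be given by $g_i(w)=\ell_i+(b_i-\ell_i)\sigma(w_i)$, where $\sigma(t)=1/(1+e^{-t})$. Let $(w_k)_{k\ge0}\subset\mathbb R^n$ satisfy $$w_{k+1}-w_k+\eta_k\nabla\Phi(x_{k+1})=0,\qquad x_{k+1}=g(w_{k+1}),\qquad k\ge0,$$ where $\eta_k\ge\underline\eta>0$ for all $k$, for a fixed constant $\underline\eta$. If $x_k\to x^\star\in[\ell,b]$, then $x^\star$ satisfies the KKT conditions of the problem $\min_{\ell\le x\le b}\Phi(x)$.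
   Context: Vector inequalities are componentwise. The KKT conditions of $\min_{\ell\le x\le b}\Phi(x)$ at $x^\star\in[\ell,b]$ are: there exist $\alpha^\star,\beta^\star\in\mathbb R^n$ with $\alpha^\star\ge0$, $\beta^\star\ge0$, $\nabla\Phi(x^\star)-\alpha^\star+\beta^\star=0$, and $\alpha_i^\star(x_i^\star-\ell_i)=0$, $\beta_i^\star(b_i-x_i^\star)=0$ for all $i$. Equivalently, for every $i$: $\nabla_i\Phi(x^\star)=0$ if $\ell_i<x_i^\star<b_i$, $\nabla_i\Phi(x^\star)\ge0$ if $x_i^\star=\ell_i$, and $\nabla_i\Phi(x^\star)\le0$ if $x_i^\star=b_i$, where $\nabla_i\Phi$ is the $i$-th component of the Euclidean gradient. *)

(* Defs.v *)
From HB Require Import structures.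
From mathcomp Require Import all_boot all_order all_algebra.
From mathcomp Require Import all_classical all_reals all_analysis.

Set Implicit Arguments.
Unset Strict Implicit.
Unset Printing Implicit Defensive.

Import Order.TTheory GRing.Theory Num.Theory.
Import numFieldNormedType.Exports.

Local Open Scope classical_set_scope.
Local Open Scope ring_scope.

(* Vectors of R^n are row vectors 'rV[R]_n; their library norm is the sup norm,
   which gives the usual topology and the usual locally Lipschitz functions. *)

Definition box (R : realType) (n : nat) (l b : 'rV[R]_n) : set 'rV[R]_n :=
  [set x | forall i, l 0 i <= x 0 i <= b 0 i].

Definition sigmoid (R : realType) (t : R) : R := 1 / (1 + expR (- t)).

Definition sigmoid_map (R : realType) (n : nat) (l b w : 'rV[R]_n) : 'rV[R]_n :=
  \row_i (l 0 i + (b 0 i - l 0 i) * sigmoid (w 0 i)).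

Definition gradient (R : realType) (n : nat) (Phi : 'rV[R]_n -> R)
    (x : 'rV[R]_n) : 'rV[R]_n :=
  \row_i 'D_(delta_mx 0 i) Phi x.

(* Phi is a total function, but only its values on the open set U matter. *)
Definition continuously_differentiable_on (R : realType) (n : nat)
    (U : set 'rV[R]_n) (Phi : 'rV[R]_n -> R) : Prop :=
  (forall x, U x -> differentiable Phi x) /\
  {within U, continuous (gradient Phi)}.

(* The library's [locally [lipschitz f y | y in U]] quantifies over all pairs
   of points of U, not only over the diagonal; hence this direct definition. *)
Definition locally_lipschitz_on (R : realType) (n : nat) (U : set 'rV[R]_n)
    (f : 'rV[R]_n -> 'rV[R]_n) : Prop :=
  forall x, U x ->
    exists2 V : set 'rV[R]_n, nbhs x V & [lipschitz f y | y in V `&` U].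

(* Feasibility of x is not part of the definition: it is only used at points
   of box l b. *)
Definition kkt_box (R : realType) (n : nat) (l b : 'rV[R]_n)
    (Phi : 'rV[R]_n -> R) (x : 'rV[R]_n) : Prop :=
  exists alpha beta : 'rV[R]_n,
    [/\ forall i, 0 <= alpha 0 i,
        forall i, 0 <= beta 0 i,
        gradient Phi x - alpha + beta = 0,
        forall i, alpha 0 i * (x 0 i - l 0 i) = 0
      & forall i, beta 0 i * (b 0 i - x 0 i) = 0].

(* Main.v *)
Require Import Defs.
From HB Require Import structures.
From mathcomp Require Import all_boot all_order all_algebra.
From mathcomp Require Import all_classical all_reals all_analysis.
From mathcomp Require Import ring lra.

Import Order.TTheory GRing.Theory Num.Theory.
Import numFieldNormedType.Exports.

Local Open Scope classical_set_scope.
Local Open Scope ring_scope.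

(** The iteration runs an implicit gradient step in the unbounded variable
    [w], so a coordinate of the gradient that does not vanish in the limit
    pushes the same coordinate of [w] always in the same direction, by an
    amount bounded below thanks to the lower bound on the step sizes.  That
    coordinate of [w] is thus driven to infinity ([cvgry_of_drift]), the
    sigmoid saturates ([cvg_sigmoid_pinfty]), and the same coordinate of [x]
    tends to the corresponding endpoint of its interval: the lower one when
    the gradient is positive, the upper one when it is negative
    ([sigmoid_descent_cvg0], [sigmoid_descent_cvg1]).

    By continuity, the gradient along the iterates tends to the gradient at
    the limit point.  Hence a coordinate where the limiting gradient is
    positive (negative) must sit at its lower (upper) bound, and the positive
    and negative parts of the gradient are then multipliers satisfying
    complementary slackness ([kkt_box_of_sign]). *)

Lemma cvgry_of_drift (R : realType) (u : nat -> R) (c : R) :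
  0 < c -> (\forall k \near \oo, u k + c <= u k.+1) -> u @ \oo --> +oo.
Proof.
move=> c0 [N _ hN]; apply/cvgryPge => A.
have lin m : u N + c * m%:R <= u (N + m)%N.
  elim: m => [|m IHm]; first by rewrite mulr0 addr0 addn0.
  have /= := hN (N + m)%N (leq_addr m N).
  by rewrite addnS -natr1; lra.
near=> k.
have Nk : (N <= k)%N by near: k; exact: nbhs_infty_ge.
have Ak : (A - u N) / c + N%:R <= k%:R by near: k; exact: nbhs_infty_ger.
rewrite -(subnKC Nk); apply: le_trans (lin _).
rewrite natrB // -lerBlDl mulrC -ler_pdivrMr //; lra.
Unshelve. all: by end_near.
Qed.

Lemma sigmoidN (R : realType) (t : R) : sigmoid (- t) = 1 - sigmoid t.
Proof.
have e0 := expR_gt0 t.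
rewrite /sigmoid opprK expRN; field.
by apply/andP; split; lra.
Qed.

Lemma cvg_sigmoid_pinfty (R : realType) : @sigmoid R t @[t --> +oo] --> (1 : R).
Proof.
(* The deficit 1 - sigmoid t = e^(-t) / (1 + e^(-t)) is at most e^(-t). *)
apply: (@squeeze_cvgr _ _ _ _ (fun t => 1 - expR (- t)) (fun=> 1)).
- apply: nearW => t; have e0 := expR_gt0 (- t).
  have d0 : 0 < 1 + expR (- t) by lra.
  by rewrite /sigmoid ler_pdivlMr // ler_pdivrMr //; apply/andP; split; nra.
- rewrite -[X in _ --> X]subr0.
  by apply: cvgB; [exact: cvg_cst | exact: cvgr_expR].
- exact: cvg_cst.
Qed.

Lemma sigmoid_descent_cvg1 (R : realType) (u p eta : nat -> R) (eta_low P : R) :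
  0 < eta_low -> (forall k, eta_low <= eta k) ->
  (forall k, u k.+1 - u k + eta k * p k = 0) ->
  p @ \oo --> P -> P < 0 -> sigmoid (u k) @[k --> \oo] --> (1 : R).
Proof.
move=> el0 hel step pP P0.
have u_drift : \forall k \near \oo, u k + eta_low * (- P / 2) <= u k.+1.
  near=> k.
  have pk : p k < P / 2.
    by near: k; apply: (cvgr_lt _ pP); lra.
  by have := hel k; have := step k; nra.
apply: (cvg_comp _ _ _ (@cvg_sigmoid_pinfty R)).
by apply: cvgry_of_drift u_drift; rewrite mulr_gt0 //; lra.
Unshelve. all: by end_near.
Qed.

(** Negating both the iterates and the gradient preserves the recursion and
    exchanges the two ends of the sigmoid. *)
Lemma sigmoid_descent_cvg0 (R : realType) (u p eta : nat -> R) (eta_low P : R) :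
  0 < eta_low -> (forall k, eta_low <= eta k) ->
  (forall k, u k.+1 - u k + eta k * p k = 0) ->
  p @ \oo --> P -> 0 < P -> sigmoid (u k) @[k --> \oo] --> (0 : R).
Proof.
move=> el0 hel step pP P0.
have : sigmoid (- u k) @[k --> \oo] --> (1 : R).
  apply: (@sigmoid_descent_cvg1 _ _ (fun k => - p k) eta eta_low (- P)) => //.
  - by move=> k; have := step k; nra.
  - exact: cvgN.
  - by lra.
move=> /(cvgB (cvg_cst (1 : R))); rewrite subrr.
apply: cvg_trans; apply: near_eq_cvg; apply: nearW => k /=.
by rewrite !fctE sigmoidN; ring.
Qed.

(** The positive and negative parts of the gradient serve as multipliers; the
    contrapositive form of the hypotheses avoids splitting coordinates into
    interior, lower and upper ones. *)
Lemma kkt_box_of_sign (R : realType) (n : nat) (l b : 'rV[R]_n)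
    (Phi : 'rV[R]_n -> R) (x : 'rV[R]_n) :
  (forall i, 0 < gradient Phi x 0 i -> x 0 i = l 0 i) ->
  (forall i, gradient Phi x 0 i < 0 -> x 0 i = b 0 i) ->
  kkt_box l b Phi x.
Proof.
move=> xl xb.
exists (\row_i Num.max (gradient Phi x 0 i) 0).
exists (\row_i Num.max (- gradient Phi x 0 i) 0).
split=> [i|i||i|i]; rewrite ?[in X in _ <= X]mxE ?le_max ?lexx ?orbT //.
- apply/rowP => i; rewrite !mxE; set g := 'D_ _ _ _.
  by rewrite /Num.max; case: ifP; case: ifP; lra.
- rewrite [X in X * _]mxE; case: (lerP (gradient Phi x 0 i) 0) => [_|/xl ->].
    by rewrite mul0r.
  by rewrite subrr mulr0.
- rewrite [X in X * _]mxE; case: (lerP (- gradient Phi x 0 i) 0) => [_|].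
    by rewrite mul0r.
  by rewrite oppr_gt0 => /xb ->; rewrite subrr mulr0.
Qed.

Theorem proposition5p6 (R : realType) (n : nat) (l b : 'rV[R]_n)
    (hlb : forall i, l 0 i < b 0 i)
    (U : set 'rV[R]_n) (hU : open U) (hboxU : box l b `<=` U)
    (Phi : 'rV[R]_n -> R)
    (hC1 : continuously_differentiable_on U Phi)
    (hLip : locally_lipschitz_on U (gradient Phi))
    (w x : nat -> 'rV[R]_n) (eta : nat -> R) (eta_low : R)
    (heta_low : 0 < eta_low) (heta : forall k, eta_low <= eta k)
    (hstep : forall k, w k.+1 - w k + eta k *: gradient Phi (x k.+1) = 0)
    (hx : forall k, x k.+1 = sigmoid_map l b (w k.+1))
    (xstar : 'rV[R]_n) (hxstar : box l b xstar)
    (hcvg : x @ \oo --> xstar) :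
  kkt_box l b Phi xstar.
Proof.
pose G := gradient Phi.
have coord_cvg (v : nat -> 'rV[R]_n) (y : 'rV[R]_n) i :
    v @ \oo --> y -> v k 0 i @[k --> \oo] --> y 0 i.
  move=> vy; exact: (cvg_comp v (fun M : 'rV[R]_n => M 0 i) vy
    (@coord_continuous _ _ _ 0 i y)).
have x1_cvg : x k.+1 @[k --> \oo] --> xstar by rewrite (cvg_shiftS x).
have grad_cvg i : (G (x k.+1)) 0 i @[k --> \oo] --> G xstar 0 i.
  have Gcont : {for xstar, continuous G}.
    have [_] := hC1; rewrite continuous_open_subspace //; apply.
    by rewrite inE; exact: hboxU.
  apply: (coord_cvg (fun k => G (x k.+1))).
  exact: cvg_comp x1_cvg Gcont.
have x_cvg i : x k.+1 0 i @[k --> \oo] --> xstar 0 i.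
  exact: (coord_cvg (fun k => x k.+1)) x1_cvg.
have step i k : w k.+1 0 i - w k 0 i + eta k * G (x k.+1) 0 i = 0.
  by have /rowP/(_ i) := hstep k; rewrite /G !mxE.
(* Saturation of a sigmoid at s = 0 or s = 1 places xstar at a bound. *)
have limit i (s : R) : sigmoid (w k 0 i) @[k --> \oo] --> s ->
    xstar 0 i = l 0 i + (b 0 i - l 0 i) * s.
  rewrite -(cvg_shiftS (fun k => sigmoid (w k 0 i))) => ws.
  apply: (cvg_unique _ (x_cvg i)) => //.
  have -> : (fun k => x k.+1 0 i) =
      (fun k => l 0 i + (b 0 i - l 0 i) * sigmoid (w k.+1 0 i)).
    by apply/funext => k; rewrite hx mxE.
  by apply: cvgD; [exact: cvg_cst | apply: cvgMl_tmp].
apply: kkt_box_of_sign => i Gi.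
- by rewrite (limit i 0) ?mulr0 ?addr0 //;
    exact: sigmoid_descent_cvg0 heta_low heta (step i) (grad_cvg i) Gi.
- rewrite (limit i 1); first by rewrite mulr1 addrC subrK.
  exact: sigmoid_descent_cvg1 heta_low heta (step i) (grad_cvg i) Gi.
Qed.
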